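(* Let $d\ge1$, $D>0$, $\sigma\ge0$, $\alpha\in[0,1)$, $\rho>0$, and let $T$ be an even positive integer. Let $w^*\in\mathbb{R}^d$ with $\|w^*\|\le D$, and let $(x,\epsilon,b)$ be mutually independent random variables with $x\in\mathbb{R}^d$, $\|x\|\le1$ a.s., $\Sigma:=\mathbb{E}[(x-\mathbb{E}x)(x-\mathbb{E}x)^T]\succeq\rho I$, $\epsilon\in\mathbb{R}$, $|\epsilon|\le\sigma$ a.s., $\mathbb{E}\epsilon=0$, $b\in\mathbb{R}$, $\mathbb{P}(b\ne0)=\alpha$; set $y=\langle w^*,x\rangle+\epsilon+b$. Let $R=6D+\sigma$, $\lambda=(1-\alpha)\rho$, and let $\bar w$ be the output of the following algorithm (which is given $\mathbb{E}[x]$): set $w_1=0$; for $t=1,\dots,T$, draw a fresh independent sample $(x_t,y_t)$ distributed as $(x,y)$, set $\eta_t=\frac{1}{\lambda t}$, $g_t=\phi_R(\langle w_t,x_t-\mathbb{E}x\rangle-y_t)\,(x_t-\mathbb{E}x)$, $w_{t+1}=\Pi_{\mathcal W}(w_t-\eta_t g_t)$; output $\bar w=\frac2T\sum_{t=T/2+1}^{T}w_t$. Then $$\mathbb{E}\|\bar w-w^*\|^2\le\frac{72R^2}{((1-\alpha)\rho)^2\,T}.$$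
   Context: $\mathcal W=\{w\in\mathbb{R}^d:\|w\|\le D\}$, $\Pi_{\mathcal W}$ is the Euclidean projection onto $\mathcal W$, and $\phi_R(s)=\min\{R,\max\{s,-R\}\}$ (the derivative of the Huber loss $h_R(s)=\frac12s^2$ for $|s|\le R$, $R(|s|-\frac12R)$ otherwise). The expectation is over the samples drawn by the algorithm. *)

(* Defs.v *)
From HB Require Import structures.
From mathcomp Require Import all_boot all_order all_algebra.
From mathcomp Require Import all_classical all_reals all_analysis.
Set Implicit Arguments. Unset Strict Implicit. Unset Printing Implicit Defensive.
Import Order.TTheory GRing.Theory Num.Theory.
Local Open Scope classical_set_scope.
Local Open Scope ring_scope.

Section defs.
Context {R : realType}.

Definition dotv {d : nat} (u v : 'rV[R]_d) : R := \sum_(i < d) u ord0 i * v ord0 i.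
Definition norm2 {d : nat} (v : 'rV[R]_d) : R := Num.sqrt (dotv v v).

(* the coordinates of a vector, as an element of the measurable space
   d.-tuple R (product Borel sigma-algebra) *)
Definition rv2tuple {d : nat} (v : 'rV[R]_d) : d.-tuple R := [tuple v ord0 i | i < d].

Definition phiR (Rc s : R) : R := Num.min Rc (Num.max s (- Rc)).

Definition projW {d : nat} (D : R) (v : 'rV[R]_d) : 'rV[R]_d :=
  if norm2 v <= D then v else (D / norm2 v) *: v.

(* iterates of the algorithm: sgd_iter k = w_{k+1}; w_1 = 0 and
   w_{t+1} = Pi_W (w_t - eta_t g_t), eta_t = 1/(lam t),
   g_t = phi_R(<w_t, x_t - m> - y_t) (x_t - m),
   where the t-th sample (t = 1,2,...) is (xs (t-1), ys (t-1)). *)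
Fixpoint sgd_iter {d : nat} (D Rc lam : R) (m : 'rV[R]_d)
    (xs : nat -> 'rV[R]_d) (ys : nat -> R) (k : nat) : 'rV[R]_d :=
  match k with
  | 0 => 0
  | k'.+1 =>
      let w := sgd_iter D Rc lam m xs ys k' in
      let eta := (lam * (k'.+1)%:R)^-1 in
      let g := phiR Rc (dotv w (xs k' - m) - ys k') *: (xs k' - m) in
      projW D (w - eta *: g)
  end.

Definition sgd_output {d : nat} (D Rc lam : R) (m : 'rV[R]_d)
    (xs : nat -> 'rV[R]_d) (ys : nat -> R) (T : nat) : 'rV[R]_d :=
  (2 / T%:R) *: \sum_(T./2 <= k < T) sgd_iter D Rc lam m xs ys k.

End defs.

Section prob_defs.
Context {dO : measure_display} {O : measurableType dO} {R : realType}.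
Variable P : probability O R.

Definition sigmaRV {dV} {V : measurableType dV} (X : O -> V) : set (set O) :=
  preimage_set_system setT X measurable.

Definition mutually_independent (I : finType) (F : I -> set (set O)) : Prop :=
  forall (J : {set I}) (A : I -> set O),
    (forall i, i \in J -> F i (A i)) ->
    P (\bigcap_(i in (fun i => i \in J)) A i) = (\prod_(i in J) P (A i))%E.

Definition same_law {dV} {V : measurableType dV} (X Y : O -> V) : Prop :=
  forall A : set V, measurable A -> P (X @^-1` A) = P (Y @^-1` A).

Definition meanv {d : nat} (X : O -> 'rV[R]_d) : 'rV[R]_d :=
  \row_i fine ('E_P[fun w => X w ord0 i]).

Definition covmx {d : nat} (X : O -> 'rV[R]_d) : 'M[R]_d :=
  \matrix_(i, j) fine ('E_P[fun w => (X w ord0 i - meanv X ord0 i) *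
                                      (X w ord0 j - meanv X ord0 j)]).

Definition triple {d : nat} (X : O -> 'rV[R]_d) (E B : O -> R) :
    O -> (d.-tuple R * R) * R :=
  fun w => ((rv2tuple (X w), E w), B w).

End prob_defs.

Definition psd_ge {R : realType} {d : nat} (A : 'M[R]_d) (c : R) : Prop :=
  forall u : 'rV[R]_d, 0 <= (u *m (A - c%:M) *m u^T) ord0 ord0.

(* Main.v *)
Require Import Defs.
From HB Require Import structures.
From mathcomp Require Import all_boot all_order all_algebra.
From mathcomp Require Import all_classical all_reals all_analysis.
From mathcomp Require Import measurable_realfun ring lra.
Import Order.TTheory GRing.Theory Num.Theory.
Local Open Scope classical_set_scope.
Local Open Scope ring_scope.

(** Put [v = w_t - w*], [u = <v, x_t - E x>] and [z = <w*, E x> + eps_t + b_t],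
so that [<g_t, v> = phi_R(u - z) u].  Where [b_t = 0] the argument of [phi_R]
is at most [5 D + sigma <= R], so [phi_R] is linear there; elsewhere it is
still monotone.  Hence, almost surely,
[phi_R(u - z) u >= 1_(b_t = 0) u^2 + phi_R(- z) u].
Since [x_t] is independent of [(eps_t, b_t)] and of the past and
[x_t - E x] is centred, the last term has mean zero, and the first one has mean
[(1 - alpha) E (v^T Sigma v) >= lam E |v|^2].  With [|g_t| <= 2 R] this gives
[E |w_(t+1) - w*|^2 <= (1 - 2 / t) E |w_t - w*|^2 + 4 R^2 / (lam t)^2],
hence [E |w_t - w*|^2 <= 8 R^2 / (lam^2 t)] for [t >= 2], and the average of the
last [T / 2] iterates is handled by convexity.  Expectations of products are
factored coordinatewise, so only products of two independent almost surely
bounded real variables occur. *)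

(** * Euclidean geometry and the clipping function *)

Section vectors.
Context {R : realType} {d : nat}.
Implicit Types (u v w x : 'rV[R]_d) (a c D Rc s t : R).

Lemma dotvC u v : dotv u v = dotv v u.
Proof. by apply: eq_bigr => i _; rewrite mulrC. Qed.

Lemma dotvDl u v w : dotv (u + v) w = dotv u w + dotv v w.
Proof. by rewrite -big_split; apply: eq_bigr => i _; rewrite mxE mulrDl. Qed.

Lemma dotvZl a u v : dotv (a *: u) v = a * dotv u v.
Proof. by rewrite mulr_sumr; apply: eq_bigr => i _; rewrite mxE mulrA. Qed.

Lemma dotvBl u v w : dotv (u - v) w = dotv u w - dotv v w.
Proof. by rewrite dotvDl -scaleN1r dotvZl mulN1r. Qed.

Lemma dotvZr a u v : dotv u (a *: v) = a * dotv u v.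
Proof. by rewrite dotvC dotvZl dotvC. Qed.

Lemma dotvDr u v w : dotv u (v + w) = dotv u v + dotv u w.
Proof. by rewrite dotvC dotvDl !(dotvC u). Qed.

Lemma dotvBr u v w : dotv u (v - w) = dotv u v - dotv u w.
Proof. by rewrite dotvC dotvBl !(dotvC u). Qed.

Lemma dotv_ge0 u : 0 <= dotv u u.
Proof. by apply: sumr_ge0 => i _; rewrite -expr2 sqr_ge0. Qed.

Lemma dotv_sqB u v : dotv (u - v) (u - v) = dotv u u - 2 * dotv u v + dotv v v.
Proof. by rewrite dotvBl !dotvBr (dotvC v u); ring. Qed.

Lemma dotv0l u : dotv 0 u = 0.
Proof. by rewrite -(scale0r 0) dotvZl mul0r. Qed.

Lemma norm2_ge0 u : 0 <= norm2 u.
Proof. exact: sqrtr_ge0. Qed.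

Lemma norm2_sq u : norm2 u ^+ 2 = dotv u u.
Proof. by rewrite sqr_sqrtr ?dotv_ge0. Qed.

Lemma norm2_eq0 u : (norm2 u == 0) = (u == 0).
Proof.
apply/idP/eqP => [|->]; last by rewrite /norm2 dotv0l sqrtr0.
rewrite -sqrf_eq0 norm2_sq psumr_eq0 => [/allP u0|i _]; last first.
  by rewrite -expr2 sqr_ge0.
apply/rowP => i; rewrite mxE.
by have := u0 i (mem_index_enum i); rewrite -expr2 sqrf_eq0 => /eqP.
Qed.

(** Cauchy-Schwarz. For nonzero vectors with norms [a] and [b], the square of [b *: u - a *: v]
    equals 2 a b (a b - <u, v>), and it is nonnegative. *)
Lemma dotv_le_norm2 u v : dotv u v <= norm2 u * norm2 v.
Proof.
have [->|u0] := eqVneq u 0; first by rewrite dotv0l mulr_ge0 ?norm2_ge0.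
have [->|v0] := eqVneq v 0.
  by rewrite dotvC dotv0l mulr_ge0 ?norm2_ge0.
have p x : x != 0 -> 0 < norm2 x by rewrite lt0r norm2_eq0 norm2_ge0 => ->.
have := dotv_ge0 (norm2 v *: u - norm2 u *: v).
rewrite dotv_sqB !dotvZl !dotvZr -!norm2_sq.
have := p _ u0; have := p _ v0; set a := norm2 u; set b := norm2 v => b0 a0.
have -> : b * (b * a ^+ 2) - 2 * (b * (a * dotv u v)) + a * (a * b ^+ 2)
   = 2 * (a * b) * (a * b - dotv u v) by ring.
by rewrite pmulr_rge0 ?subr_ge0// !mulr_gt0.
Qed.

Lemma normr_dotv u v : `|dotv u v| <= norm2 u * norm2 v.
Proof.
rewrite ler_norml dotv_le_norm2 andbT lerNl -mulN1r -dotvZl.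
rewrite (le_trans (dotv_le_norm2 _ _))// /norm2 dotvZl dotvZr.
by rewrite mulN1r mulN1r opprK.
Qed.

Lemma norm2Z a u : 0 <= a -> norm2 (a *: u) = a * norm2 u.
Proof.
move=> a0; rewrite /norm2 dotvZl dotvZr mulrA sqrtrM ?mulr_ge0//.
by rewrite -expr2 sqrtr_sqr ger0_norm.
Qed.

Lemma ler_norm2D u v : norm2 (u + v) <= norm2 u + norm2 v.
Proof.
rewrite -ler_sqr ?nnegrE ?addr_ge0 ?norm2_ge0//.
rewrite norm2_sq dotvDl !dotvDr (dotvC v u) sqrrD !norm2_sq.
have := dotv_le_norm2 u v; lra.
Qed.

Lemma norm2N u : norm2 (- u) = norm2 u.
Proof. by rewrite /norm2 -scaleN1r dotvZl dotvZr !mulN1r opprK. Qed.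

Lemma ler_norm2B u v : norm2 (u - v) <= norm2 u + norm2 v.
Proof. by rewrite (le_trans (ler_norm2D _ _))// norm2N. Qed.

Lemma ler_coord_norm2 u i : `|u ord0 i| <= norm2 u.
Proof.
rewrite -ler_sqr ?nnegrE ?norm2_ge0 ?normr_ge0// norm2_sq.
rewrite real_normK ?num_real// /dotv (bigD1 i)//= -expr2 lerDl.
by apply: sumr_ge0 => j _; rewrite -expr2 sqr_ge0.
Qed.

Lemma norm2_projW D v : 0 < D -> norm2 (projW D v) <= D.
Proof.
move=> D0; rewrite /projW; case: (leP (norm2 v) D) => // vD.
have v0 : 0 < norm2 v by exact: lt_trans vD.
by rewrite norm2Z ?divfK ?gt_eqF// divr_ge0 ?norm2_ge0 ?(ltW D0).
Qed.

(** Only distances to a fixed point [w] of the ball are needed, since the analysis tracks the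
    distance to [wstar]. Outside the ball the projection is c v with c = D / |v| < 1, and the claim
    becomes a scalar inequality. *)
Lemma projW_contract D v w : 0 < D -> norm2 w <= D ->
  dotv (projW D v - w) (projW D v - w) <= dotv (v - w) (v - w).
Proof.
move=> D0 wD; rewrite /projW; case: (leP (norm2 v) D) => // vD.
have v0 : 0 < norm2 v by exact: lt_trans vD.
rewrite !dotv_sqB !dotvZl !dotvZr -(norm2_sq v).
have := dotv_le_norm2 v w.
set n := norm2 v in v0 vD *; set c := D / n.
have cn : D = c * n by rewrite /c divfK ?gt_eqF.
have c0 : 0 < c by exact: divr_gt0.
have c1 : c < 1 by rewrite ltr_pdivrMr ?mul1r.
move=> vw; have {}vw : dotv v w <= c * n ^+ 2.
  rewrite (le_trans vw)// expr2 mulrCA -cn.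
  by rewrite ler_wpM2l// ltW.
(* This product is the difference of the two sides of the goal. Its second factor is at least (1 -
   c) n^2, because <v, w> <= c n^2. *)
have : 0 <= (1 - c) * ((1 + c) * n ^+ 2 - 2 * dotv v w).
  apply: mulr_ge0; first by rewrite subr_ge0 ltW.
  have : 0 <= (1 - c) * n ^+ 2 by rewrite mulr_ge0 ?sqr_ge0// subr_ge0 ltW.
  lra.
lra.
Qed.

(** Sums 2 <u, f i> <= |u|^2 + |f i|^2. It controls the cross terms when one more vector is added in
    [dotv_sum_sq_le]. *)
Lemma dotv_sumr_le (I : Type) (s : seq I) (f : I -> 'rV[R]_d) u :
  2 * dotv u (\sum_(i <- s) f i) <=
  (size s)%:R * dotv u u + \sum_(i <- s) dotv (f i) (f i).
Proof.
elim: s => [|i s ih]; first by rewrite !big_nil dotvC dotv0l mulr0 mul0r addr0.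
rewrite !big_cons dotvDr /= -[(size s).+1]addn1 natrD.
have := dotv_ge0 (u - f i); rewrite dotv_sqB => h; move: ih h; lra.
Qed.

Lemma dotv_sum_sq_le (I : Type) (s : seq I) (f : I -> 'rV[R]_d) :
  dotv (\sum_(i <- s) f i) (\sum_(i <- s) f i) <=
  (size s)%:R * \sum_(i <- s) dotv (f i) (f i).
Proof.
elim: s => [|i s ih]; first by rewrite !big_nil dotv0l mul0r.
rewrite !big_cons dotvDl !dotvDr (dotvC _ (f i)) /= -[(size s).+1]addn1 natrD.
by move: ih (dotv_sumr_le I s f (f i)); lra.
Qed.

Lemma phiR_le Rc s t : s <= t -> phiR Rc s <= phiR Rc t.
Proof.
move=> st; rewrite /phiR le_min ge_min lexx /= ge_min orbC.
by rewrite ge_max !le_max st lexx orbT.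
Qed.

Lemma normr_phiR Rc s : 0 <= Rc -> `|phiR Rc s| <= Rc.
Proof.
move=> R0; rewrite ler_norml /phiR ge_min lexx /= le_min andbT le_max lexx.
by rewrite orbT andbT ge0_cp.
Qed.

Lemma phiR_id Rc s : `|s| <= Rc -> phiR Rc s = s.
Proof.
by rewrite ler_norml => /andP[h1 h2]; rewrite /phiR (max_l h1) (min_r h2).
Qed.

(* For [good = false] only the monotonicity of [phiR] is used; [good] keeps both arguments in the range where [phiR] is the identity. *)
Lemma phiR_coercive Rc (u z : R) (good : bool) :
  (good -> `|u - z| <= Rc /\ `|z| <= Rc) ->
  good%:R * u ^+ 2 + phiR Rc (- z) * u <= phiR Rc (u - z) * u.
Proof.
case: good => [/(_ isT)[h1 h2]|_].
  by rewrite !phiR_id ?normrN// mul1r expr2 -mulrDl.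
rewrite mul0r add0r -subr_ge0 -mulrBl.
case: (leP 0 u) => u0.
  by apply: mulr_ge0 => //; rewrite subr_ge0 phiR_le// lerDr.
apply: mulr_le0; last exact: ltW.
by rewrite subr_le0 phiR_le// gerDr ltW.
Qed.

Lemma psd_ge_quad (A : 'M[R]_d) (c : R) u : psd_ge A c ->
  c * dotv u u <= \sum_i \sum_j A i j * (u ord0 i * u ord0 j).
Proof.
move=> /(_ u); set q := (_ *m _) _ _ => q0; rewrite -subr_ge0.
suff <- : q = \sum_i \sum_j A i j * (u ord0 i * u ord0 j) - c * dotv u u by [].
rewrite /q mulmxBr mulmxBl mxE [in X in _ + X]mxE; congr (_ - _).
  rewrite mxE exchange_big/=; apply: eq_bigr => j _; rewrite mxE mulr_suml.
  by apply: eq_bigr => i _; rewrite mxE; ring.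
rewrite mul_mx_scalar -scalemxAl !mxE; congr (_ * _).
by apply: eq_bigr => i _; rewrite mxE.
Qed.

End vectors.

(** Index [k] stands for the iterate w_(k+1). The first step has coefficient 1 - 2 = -1, so [a 0]
    drops out and a 1 <= G whatever the starting error; from then on the coefficient is nonnegative
    and the bound propagates by induction. *)
Lemma recurrence_rate {R : realType} (a : nat -> R) (G : R) (N : nat) :
  0 <= G -> 0 <= a 0%N ->
  (forall k, (k < N)%N ->
    a k.+1 <= (1 - 2 / k.+1%:R) * a k + G / k.+1%:R ^+ 2) ->
  forall k, (0 < k <= N)%N -> a k <= 2 * G / k.+1%:R.
Proof.
move=> G0 a0 rec; elim=> // -[_ /= N1|k ih /= kN].
  have := rec _ N1; rewrite expr1n !divr1 => h; move: h a0; lra.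
apply: le_trans (rec _ kN) _.
have {}ih := ih (ltnW kN).
set n : R := k.+2%:R in ih *.
have n2 : 2 <= n by rewrite ler_nat.
have n0 : 0 < n by lra.
have c0 : 0 <= 1 - 2 / n by rewrite subr_ge0 ler_pdivrMr ?mul1r.
apply: (@le_trans _ _ ((1 - 2 / n) * (2 * G / n) + G / n ^+ 2)).
  by rewrite lerD2r ler_wpM2l.
rewrite (_ : k.+3%:R = n + 1); last by rewrite natr1.
have -> : (1 - 2 / n) * (2 * G / n) + G / n ^+ 2 = G * (2 * n - 3) / n ^+ 2.
  by field; rewrite gt_eqF.
(* With denominators cleared, the claim is (2 n - 3) (n + 1) = 2 n^2 - n - 3 <= 2 n^2. *)
rewrite ler_pdivrMr ?exprn_gt0// mulrAC ler_pdivlMr; last lra.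
rewrite -!mulrA mulrCA ler_wpM2l//.
nra.
Qed.

(** * Almost surely bounded random variables and independence *)

Section ae_bounded.
Context {dO : measure_display} {O : measurableType dO} {R : realType}.
Context {P : probability O R}.
Implicit Types (f g : O -> R).

(** A class closed under sums and products whose members are all integrable. Linearity and
    monotonicity of the real-valued integral then need no further integrability conditions. *)
Definition ae_bounded f :=
  measurable_fun setT f /\ exists M : R, {ae P, forall w, `|f w| <= M}.

Lemma ae_bounded_cst (c : R) : ae_bounded (fun=> c).
Proof. by split; [exact: measurable_cst|exists `|c|; exact: aeW]. Qed.

Lemma ae_boundedD f g : ae_bounded f -> ae_bounded g ->
  ae_bounded (fun w => f w + g w).
Proof.
move=> [mf [M fM]] [mg [N gN]]; split; first exact: measurable_funD.
exists (M + N); apply: filterS2 fM gN => w fM gN.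
by rewrite (le_trans (ler_normD _ _))// lerD.
Qed.

Lemma ae_boundedM f g : ae_bounded f -> ae_bounded g ->
  ae_bounded (fun w => f w * g w).
Proof.
move=> [mf [M fM]] [mg [N gN]]; split; first exact: measurable_funM.
exists (M * N); apply: filterS2 fM gN => w fM gN.
by rewrite normrM ler_pM.
Qed.

Lemma ae_boundedB f g : ae_bounded f -> ae_bounded g ->
  ae_bounded (fun w => f w - g w).
Proof.
move=> bf bg; under eq_fun do rewrite -mulN1r.
by apply: ae_boundedD => //; apply: ae_boundedM => //; exact: ae_bounded_cst.
Qed.

Lemma ae_bounded_sum (I : Type) (s : seq I) (Q : pred I) (f : I -> O -> R) :
  (forall i, ae_bounded (f i)) ->
  ae_bounded (fun w => \sum_(i <- s | Q i) f i w).
Proof.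
move=> bf; elim: s => [|i s ih].
  by under eq_fun do rewrite big_nil; exact: ae_bounded_cst.
under eq_fun do rewrite big_cons; case: (Q i) => //.
exact: ae_boundedD.
Qed.

Lemma ae_bounded_integrable f : ae_bounded f ->
  P.-integrable setT (EFin \o f).
Proof.
move=> [mf [M fM]]; apply/integrableP; split; first exact/measurable_EFinP.
apply: (@le_lt_trans _ _ (\int[P]_w (cst `|M|%:E) w)%E); last first.
  by rewrite integral_cst//= probability_setT mule1 ltry.
apply: ae_ge0_le_integral => //.
- by apply: measurableT_comp => //; exact/measurable_EFinP.
- by move=> w _; rewrite lee_fin.
- by apply: filterS fM => w fM _ /=; rewrite lee_fin (le_trans fM)// ler_norm.
Qed.

Lemma expectation_Rintegral f : ae_bounded f ->
  'E_P[f]%E = (\int[P]_w f w)%:E.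
Proof.
move=> bf; rewrite unlock /Rintegral fineK//.
exact: integrable_fin_num (ae_bounded_integrable f bf).
Qed.

Lemma ae_RintegralD f g : ae_bounded f -> ae_bounded g ->
  \int[P]_w (f w + g w) = \int[P]_w f w + \int[P]_w g w.
Proof.
by move=> bf bg; rewrite RintegralD//; exact: ae_bounded_integrable.
Qed.

Lemma ae_RintegralB f g : ae_bounded f -> ae_bounded g ->
  \int[P]_w (f w - g w) = \int[P]_w f w - \int[P]_w g w.
Proof.
by move=> bf bg; rewrite RintegralB//; exact: ae_bounded_integrable.
Qed.

Lemma ae_RintegralZl f (c : R) : ae_bounded f ->
  \int[P]_w (c * f w) = c * \int[P]_w f w.
Proof.
by move=> bf; rewrite RintegralZl//; exact: ae_bounded_integrable.
Qed.

Lemma Rintegral_probability_cst (c : R) : \int[P]_w c = c.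
Proof.
rewrite /Rintegral (_ : (fun=> c%:E) = cst c%:E)//.
by rewrite integral_cst//= probability_setT mule1.
Qed.

Lemma ae_Rintegral_sum (I : Type) (s : seq I) (Q : pred I) (f : I -> O -> R) :
  (forall i, ae_bounded (f i)) ->
  \int[P]_w (\sum_(i <- s | Q i) f i w) =
  \sum_(i <- s | Q i) \int[P]_w f i w.
Proof.
move=> bf; elim: s => [|i s ih].
  rewrite big_nil -[RHS](Rintegral_probability_cst 0).
  by under eq_Rintegral do rewrite big_nil.
under eq_Rintegral do rewrite big_cons; rewrite big_cons; case: (Q i) => //.
by rewrite ae_RintegralD ?ih//; exact: ae_bounded_sum.
Qed.

(** The difference [g - f] is nonnegative only almost everywhere, so it is replaced by its absolute
    value, which has the same integral and is nonnegative everywhere. *)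
Lemma ae_le_Rintegral f g : ae_bounded f -> ae_bounded g ->
  {ae P, forall w, f w <= g w} -> \int[P]_w f w <= \int[P]_w g w.
Proof.
move=> bf bg fg; rewrite -subr_ge0 -ae_RintegralB//.
have [mh _] := ae_boundedB _ _ bg bf.
rewrite /Rintegral (@ae_eq_integral _ _ _ P setT (fun w => `|g w - f w|%:E)).
- by rewrite fine_ge0// integral_ge0// => w _; rewrite lee_fin.
- by [].
- exact/measurable_EFinP.
- by apply/measurable_EFinP; exact: measurableT_comp.
- by apply: filterS fg => w fg _ /=; rewrite ger0_norm// subr_ge0.
Qed.

(** The joint law of [f] and [g] is the product of their laws, and Fubini splits the integral of the
    product. *)
Lemma Rintegral_indepM f g : ae_bounded f -> ae_bounded g ->
  (forall A B, measurable A -> measurable B ->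
    P (f @^-1` A `&` g @^-1` B) = (P (f @^-1` A) * P (g @^-1` B))%E) ->
  \int[P]_w (f w * g w) = \int[P]_w f w * \int[P]_w g w.
Proof.
move=> bf bg fg.
have [mf _] := bf; have [mg _] := bg.
have mfg : measurable_fun setT (fun w => (f w, g w)).
  exact: measurable_fun_pair.
pose X : {RV P >-> R} := mfun_Sub (mem_set mf).
pose Y : {RV P >-> R} := mfun_Sub (mem_set mg).
pose Z : {RV P >-> (R * R)%type} := mfun_Sub (mem_set mfg).
pose F (p : R * R) := (p.1 * p.2)%:E.
have mF : measurable_fun setT F.
  apply/measurable_EFinP; exact: measurable_funM.
have ifg := ae_bounded_integrable _ (ae_boundedM _ _ bf bg).
(* The hypothesis says that the two measures agree on rectangles, which determines the product
   measure. *)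
have prodE A : measurable A ->
    (distribution P X \x distribution P Y)%E A = distribution P Z A.
  by move=> mA; apply: product_measure_unique.
have E1 : (\int[P]_w (f w * g w)%:E = \int[distribution P Z]_p F p)%E.
  by rewrite integral_distribution.
(* Integrability for Fubini is checked under the joint law, where it is that of [f * g], and then
   carried over to the product measure. *)
have iF : (distribution P X \x distribution P Y)%E.-integrable setT F.
  have /integrableP[_ h] : (distribution P Z).-integrable setT F.
    by apply: (integrable_pushforward (measurable_funP Z)).
  apply/integrableP; split=> //.
  by rewrite (eq_measure_integral (distribution P Z))// => S mS _; exact: prodE.
have E2 : (\int[P]_w (f w * g w)%:E =
    \int[distribution P X]_x \int[distribution P Y]_y (x * y)%:E)%E.
  rewrite E1 (integral12_prod_meas1 iF).
  by apply: eq_measure_integral => A mA _; exact/esym/prodE.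
have iX := ae_bounded_integrable _ bf; have iY := ae_bounded_integrable _ bg.
have idY : (distribution P Y).-integrable setT (fun y : R => y%:E).
  apply: (integrable_pushforward (measurable_funP Y)) => //.
  exact: EFin_measurable.
have idX : (distribution P X).-integrable setT (fun y : R => y%:E).
  apply: (integrable_pushforward (measurable_funP X)) => //.
  exact: EFin_measurable.
have EY : (\int[distribution P Y]_y y%:E = (\int[P]_w g w)%:E)%E.
  rewrite /Rintegral fineK; last exact: integrable_fin_num.
  by rewrite integral_distribution.
have EX : (\int[distribution P X]_y y%:E = (\int[P]_w f w)%:E)%E.
  rewrite /Rintegral fineK; last exact: integrable_fin_num.
  by rewrite integral_distribution.
rewrite {1}/Rintegral E2.
under eq_integral.
  move=> x _; under eq_integral do rewrite EFinM.
  rewrite integralZl// EY; over.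
by rewrite integralZr// EX -EFinM.
Qed.

End ae_bounded.
Arguments ae_bounded {dO O R} P f.

Section independence.
Context {dO : measure_display} {O : measurableType dO} {R : realType}.
Variable P : probability O R.
Context {I : finType} (F : I -> set (set O)).

(** For fixed [A], both P (A [&] B) and P A * P B are finite measures in [B]. They agree on the
    pi-system [G] of intersections of one event per index of [K], hence on the sigma-algebra it
    generates. *)
Lemma indep_generated (i0 : I) (K : {set I}) :
  mutually_independent P F ->
  (forall i, F i `<=` measurable) -> (forall i, F i setT) ->
  (forall i, setI_closed (F i)) -> i0 \notin K ->
  forall A B, F i0 A -> <<s \bigcup_(i in [set` K]) F i >> B ->
    P (A `&` B) = (P A * P B)%E.
Proof.
move=> indF mF FT FI i0K A B FA.
have mA : measurable A by exact: mF FA.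
pose G := [set B | exists f : I -> set O, (forall i, F i (f i)) /\
  B = \bigcap_(i in [set` K]) f i].
have subG : \bigcup_(i in [set` K]) F i `<=` G.
  move=> C [i iK FC]; exists (fun j => if j == i then C else setT); split.
    by move=> j; case: eqP => [->|].
  apply/seteqP; split => [w Cw j _ /=|w /(_ i iK)]; first by case: eqP.
  by rewrite eqxx.
move=> /(sub_sigma_algebra2 subG) GB.
have Gm : G `<=` measurable.
  move=> _ [f [Ff ->]]; apply: fin_bigcap_measurable => // i _.
  exact: mF.
have A0 : (0 <= fine (P A))%R by rewrite fine_ge0// measure_ge0.
pose m2 := mscale (NngNum A0) P.
have PA : (fine (P A))%:E = P A by rewrite fineK// fin_num_measure.
rewrite setIC -[LHS]/(mrestr P mA B) -PA -[RHS]/(m2 B).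
apply: (g_sigma_algebra_measure_unique G Gm (fun=> setT)) => //.
- by move=> _; exists (fun=> setT); split=> //; apply/seteqP; split.
- by rewrite bigcup_const.
- move=> _ _ [f [Ff ->]] [g [Fg ->]]; exists (fun i => f i `&` g i).
  by rewrite bigcapI; split=> // i; exact: FI.
- move=> _ [f [Ff ->]].
  transitivity (P A * P (\bigcap_(i in [set` K]) f i))%E; last first.
    by rewrite -{1}PA.
  rewrite /= /mrestr.
  (* Placing [A] at the fresh index [i0] turns the event into one intersection over [i0 |: K], to
     which mutual independence applies. *)
  pose h i := if i == i0 then A else f i.
  have hK i : i \in K -> h i = f i.
    by move=> iK; rewrite /h; case: eqP iK i0K => // -> ->.
  have Fh i : F i (h i) by rewrite /h; case: eqP => [->|].
  have capE : A `&` \bigcap_(i in [set` K]) f i =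
      \bigcap_(i in [set` i0 |: K]) h i.
    apply/seteqP; split => [w [Aw fw] i /=|w hw].
      rewrite in_setU1 => /orP[/eqP ->|iK]; first by rewrite /h eqxx.
      by rewrite hK//; exact: fw.
    split; first by have := hw i0 (setU11 _ _); rewrite /h eqxx.
    by move=> i iK; rewrite -hK//; apply: hw; exact: setU1r.
  rewrite setIC capE (indF _ h (fun i _ => Fh i)) big_setU1//= {1}/h eqxx.
  congr (_ * _)%E; rewrite (eq_bigr (fun i => P (f i))) => [|i iK].
    by rewrite -indF.
  by rewrite hK.
- by move=> _; rewrite /= /mrestr setTI ltey_eq fin_num_measure.
Qed.

End independence.

(** * Measurability of the iterates and transfer along equal laws *)

Section measurable_iterates.
Context {R : realType} {d : nat} {dV : measure_display} {V : measurableType dV}.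
Implicit Types (X Y : V -> 'rV[R]_d) (f : V -> R).

(** Stated for an arbitrary source space, so that it serves both on [O] with its own sigma-algebra
    and on [O] with the sigma-algebra of a block of samples. *)
Definition measurable_coords X :=
  forall i, measurable_fun setT (fun w => X w ord0 i).

Lemma measurable_coords_rv2tuple X :
  measurable_fun setT (rv2tuple \o X) -> measurable_coords X.
Proof.
move=> /measurable_fun_tnthP mX i; apply: eq_measurable_fun (mX i) => w _ /=.
by rewrite /rv2tuple tnth_mktuple.
Qed.

Lemma measurable_coords_cst (v : 'rV[R]_d) : measurable_coords (fun=> v).
Proof. by move=> i; exact: measurable_cst. Qed.

Lemma measurable_coordsB X Y : measurable_coords X -> measurable_coords Y ->
  measurable_coords (fun w => X w - Y w).
Proof.
move=> mX mY i; under eq_fun do rewrite !mxE.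
exact: measurable_funB.
Qed.

Lemma measurable_coordsZ f X : measurable_fun setT f -> measurable_coords X ->
  measurable_coords (fun w => f w *: X w).
Proof.
move=> mf mX i; under eq_fun do rewrite mxE.
exact: measurable_funM.
Qed.

Lemma measurable_dotv X Y : measurable_coords X -> measurable_coords Y ->
  measurable_fun setT (fun w => dotv (X w) (Y w)).
Proof.
by move=> mX mY; apply: measurable_sum => i; exact: measurable_funM.
Qed.

Lemma measurable_coords_sum (I : Type) (s : seq I) (X : I -> V -> 'rV[R]_d) :
  (forall i, measurable_coords (X i)) ->
  measurable_coords (fun w => \sum_(i <- s) X i w).
Proof.
move=> mX i; under eq_fun do rewrite summxE.
by apply: measurable_sum => j; exact: mX.
Qed.

Lemma measurable_norm2 X : measurable_coords X ->
  measurable_fun setT (fun w => norm2 (X w)).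
Proof.
move=> mX; under eq_fun do rewrite /norm2 -powR12_sqrt ?dotv_ge0//.
apply: (measurableT_comp (measurable_powR _)).
exact: measurable_dotv.
Qed.

Lemma measurable_phiR Rc f : measurable_fun setT f ->
  measurable_fun setT (fun w => phiR Rc (f w)).
Proof.
move=> mf; apply: measurable_minr; first exact: measurable_cst.
by apply: measurable_maxr => //; exact: measurable_cst.
Qed.

Lemma measurable_projW D X : measurable_coords X ->
  measurable_coords (fun w => projW D (X w)).
Proof.
move=> mX i.
(* The inverse of the norm is written as a real power so that [measurable_powR] applies. *)
rewrite (_ : (fun w => _) = fun w => if norm2 (X w) <= D then X w ord0 i
    else D * norm2 (X w) `^ (-1) * X w ord0 i); last first.
  apply/funext => w; rewrite /projW; case: ifP => // _.
  by rewrite mxE powR_inv1 ?norm2_ge0.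
apply: measurable_fun_ifT => //.
  by apply: measurable_fun_ler; [exact: measurable_norm2|exact: measurable_cst].
apply: measurable_funM => //; apply: measurable_funM => //.
by apply: (measurableT_comp (measurable_powR _)); exact: measurable_norm2.
Qed.

(** Only samples with index below [k] enter the hypotheses: this is the adaptedness that later makes
    the iterate independent of the current sample. *)
Lemma measurable_sgd_iter D Rc lam (m : 'rV[R]_d) (xs : nat -> V -> 'rV[R]_d)
    (ys : nat -> V -> R) k :
  (forall s, (s < k)%N -> measurable_coords (xs s)) ->
  (forall s, (s < k)%N -> measurable_fun setT (ys s)) ->
  measurable_coords
    (fun w => sgd_iter D Rc lam m (fun s => xs s w) (fun s => ys s w) k).
Proof.
elim: k => [|k ih] mxs mys; first exact: measurable_coords_cst.
have mW : measurable_coords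
    (fun w => sgd_iter D Rc lam m (fun s => xs s w) (fun s => ys s w) k).
  by apply: ih => s sk; [apply: mxs|apply: mys]; exact: ltnW.
have mxm : measurable_coords (fun w => xs k w - m).
  by apply: measurable_coordsB; [exact: mxs|exact: measurable_coords_cst].
apply: measurable_projW; apply: measurable_coordsB => //.
apply: measurable_coordsZ => //; apply: measurable_coordsZ => //.
apply: measurable_phiR; apply: measurable_funB; last exact: mys.
exact: measurable_dotv.
Qed.

End measurable_iterates.

Section same_law.
Context {dO : measure_display} {O : measurableType dO} {R : realType}.
Context {P : probability O R}.
Context {dV : measure_display} {V : measurableType dV}.
Variables (X Y : O -> V).
Hypotheses (mX : measurable_fun setT X) (mY : measurable_fun setT Y).
Hypothesis XY : same_law P X Y.

Lemma same_law_ae (A : set V) : measurable A ->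
  {ae P, forall w, A (Y w)} -> {ae P, forall w, A (X w)}.
Proof.
move=> mA aeY.
have mC (Z : O -> V) : measurable_fun setT Z -> measurable (Z @^-1` (~` A)).
  by move=> mZ; rewrite -[X in measurable X]setTI; apply: mZ => //; exact: measurableC.
apply/negligibleP; first exact: mC.
have PY0 := proj1 (negligibleP P (mC _ mY)) aeY.
rewrite -PY0.
by apply: XY; exact: measurableC.
Qed.

Lemma same_law_ae_bounded (f : V -> R) : measurable_fun setT f ->
  ae_bounded P (f \o Y) -> ae_bounded P (f \o X).
Proof.
move=> mf [_ [M fM]]; split; first exact: measurableT_comp.
exists M; apply: (same_law_ae [set v | `|f v| <= M]) => //.
rewrite -[X in measurable X]setTI.
apply: measurable_fun_le => //; first exact: measurableT_comp.
Qed.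

Lemma same_law_Rintegral (f : V -> R) : measurable_fun setT f ->
  ae_bounded P (f \o Y) -> \int[P]_w f (X w) = \int[P]_w f (Y w).
Proof.
move=> mf bY; have bX := same_law_ae_bounded f mf bY.
have iX := ae_bounded_integrable _ bX; have iY := ae_bounded_integrable _ bY.
have mfE : measurable_fun setT (EFin \o f) by exact/measurable_EFinP.
rewrite /Rintegral; congr fine.
transitivity (\int[pushforward P X]_v (f v)%:E)%E.
  by rewrite integral_pushforward.
transitivity (\int[pushforward P Y]_v (f v)%:E)%E; last first.
  by rewrite integral_pushforward.
by apply: eq_measure_integral => A mA _; exact: XY.
Qed.

End same_law.

Section sigmaRV.
Context {dO : measure_display} {O : measurableType dO}.
Context {dV : measure_display} {V : measurableType dV}.
Implicit Type X : O -> V.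

Lemma sigmaRV_measurable X : measurable_fun setT X -> sigmaRV X `<=` measurable.
Proof. by move=> mX _ [B mB <-]; exact: mX. Qed.

Lemma sigmaRV_setT X : sigmaRV X setT.
Proof. by exists setT => //; rewrite setTI. Qed.

Lemma sigmaRV_setI X : setI_closed (sigmaRV X).
Proof.
move=> _ _ [A mA <-] [B mB <-]; exists (A `&` B); first exact: measurableI.
by rewrite !setTI.
Qed.

Lemma sigmaRV_comp {dU : measure_display} {U : measurableType dU} X (h : V -> U) :
  measurable_fun setT h ->
  forall B, measurable B -> sigmaRV X ((fun w => h (X w)) @^-1` B).
Proof.
move=> mh B mB; exists (h @^-1` B); last by rewrite setTI.
by rewrite -[X in measurable X]setTI; exact: mh.
Qed.

Lemma measurable_gsigmaRV X (G : set (set O)) : sigmaRV X `<=` G ->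
  measurable_fun [set: g_sigma_algebraType G] X.
Proof.
by move=> XG _ B mB; apply: sub_sigma_algebra; apply: XG; exists B.
Qed.

End sigmaRV.

Lemma indic_eq0E {R : realType} (r : R) :
  \1_[set (0 : R)] r = (r == 0)%:R :> R.
Proof. by rewrite indicE; congr (nat_of_bool _)%:R; apply/idP/eqP; rewrite inE. Qed.

(** * The stochastic gradient iteration *)

Section sgd_analysis.
Context {R : realType} {d : nat} {D sigma alpha rho : R} {T : nat}.
Context {wstar : 'rV[R]_d}.
Context {dO : measure_display} {O : measurableType dO} {P : probability O R}.
Context {x : O -> 'rV[R]_d} {eps b : O -> R}.
Context {xs : nat -> O -> 'rV[R]_d} {epss bs : nat -> O -> R}.
Hypotheses (D0 : 0 < D) (sigma0 : 0 <= sigma) (alpha01 : 0 <= alpha < 1).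
Hypotheses (rho0 : 0 < rho) (wstarD : norm2 wstar <= D).
Hypotheses (mx : measurable_fun setT (rv2tuple \o x)).
Hypotheses (meps : measurable_fun setT eps) (mb : measurable_fun setT b).
Hypothesis x1 : {ae P, forall w, norm2 (x w) <= 1}.
Hypothesis covx : psd_ge (covmx P x) rho.
Hypothesis epsS : {ae P, forall w, `|eps w| <= sigma}.
Hypothesis bP : P [set w | b w != 0] = alpha%:E.
Hypothesis msamples : forall t, (t < T)%N ->
  measurable_fun setT (rv2tuple \o xs t) /\
  measurable_fun setT (epss t) /\ measurable_fun setT (bs t).
Hypothesis law_samples : forall t, (t < T)%N ->
  same_law P (triple (xs t) (epss t) (bs t)) (triple x eps b).

Let F (tk : 'I_T * 'I_3) : set (set O) :=
  if val tk.2 == 0%N then sigmaRV (rv2tuple \o xs (val tk.1))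
  else if val tk.2 == 1%N then sigmaRV (epss (val tk.1))
  else sigmaRV (bs (val tk.1)).
Hypothesis indF : mutually_independent P F.

Let Rc := 6 * D + sigma.
Let lam := (1 - alpha) * rho.
Let m := meanv P x.

Let Rc0 : 0 <= Rc. Proof. by rewrite /Rc; have := D0; have := sigma0; lra. Qed.

Let lam0 : 0 < lam.
Proof. by rewrite /lam mulr_gt0// subr_gt0; case/andP: alpha01. Qed.

Lemma ae_bounded_generic i : ae_bounded P (fun w => x w ord0 i).
Proof.
split; first exact: measurable_coords_rv2tuple mx i.
by exists 1; apply: filterS x1 => w; apply: le_trans; exact: ler_coord_norm2.
Qed.

Lemma meanvE i : m ord0 i = \int[P]_w x w ord0 i.
Proof. by rewrite /m mxE unlock. Qed.

(** From |m|^2 = E <m, x> <= |m|, by Cauchy-Schwarz and |x| <= 1; then divide by |m| when it is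
    nonzero. *)
Lemma norm2_meanv : norm2 m <= 1.
Proof.
have bm : ae_bounded P (fun w => dotv m (x w)).
  apply: ae_bounded_sum => i; apply: ae_boundedM; first exact: ae_bounded_cst.
  exact: ae_bounded_generic.
have mmE : dotv m m = \int[P]_w dotv m (x w).
  rewrite ae_Rintegral_sum => [|i]; last first.
    by apply: ae_boundedM; [exact: ae_bounded_cst|exact: ae_bounded_generic].
  apply: eq_bigr => i _; rewrite ae_RintegralZl -?meanvE//.
  exact: ae_bounded_generic.
have : norm2 m ^+ 2 <= norm2 m.
  rewrite norm2_sq mmE -[leRHS](Rintegral_probability_cst (P := P)).
  apply: ae_le_Rintegral => //; first exact: ae_bounded_cst.
  apply: filterS x1 => w xw1; rewrite (le_trans (dotv_le_norm2 _ _))//.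
  by rewrite ler_piMr ?norm2_ge0.
have [->//|m0] := eqVneq (norm2 m) 0.
by rewrite expr2 ger_pMr// lt0r m0 norm2_ge0.
Qed.

(** * Transfer of bounds and moments from the generic triple to one sample *)

Section sample.
Variables (t : nat) (tT : (t < T)%N).

Let measurable_triple (Y : O -> 'rV[R]_d) (e c : O -> R) :
  measurable_fun setT (rv2tuple \o Y) -> measurable_fun setT e ->
  measurable_fun setT c -> measurable_fun setT (triple Y e c).
Proof. by move=> mY me mc; do 2 apply: measurable_fun_pair => //. Qed.

Let mtriples : measurable_fun setT (triple (xs t) (epss t) (bs t)).
Proof. by have [? [? ?]] := msamples t tT; exact: measurable_triple. Qed.

Let mtriple : measurable_fun setT (triple x eps b).
Proof. exact: measurable_triple. Qed.

(** A left inverse of the encoding in [triple]: a function of the sampled vector alone thus factors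
    through the triple, whose law is the one prescribed. *)
Let vec (p : d.-tuple R * R * R) : 'rV[R]_d := \row_i tnth p.1.1 i.

Let vec_triple (Y : O -> 'rV[R]_d) (e c : O -> R) w : vec (triple Y e c w) = Y w.
Proof. by apply/rowP => i; rewrite mxE tnth_mktuple. Qed.

Let measurable_vec : measurable_coords vec.
Proof.
move=> i; under eq_fun do rewrite mxE.
apply: (measurableT_comp (measurable_tnth i)).
exact: (measurableT_comp measurable_fst measurable_fst).
Qed.

Lemma sample_norm2 : {ae P, forall w, norm2 (xs t w) <= 1}.
Proof.
have mA : measurable [set p | norm2 (vec p) <= 1].
  rewrite -[X in measurable X]setTI.
  by apply: measurable_fun_le => //; exact: measurable_norm2.
have x1' : {ae P, forall w, [set p | norm2 (vec p) <= 1] (triple x eps b w)}.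
  by apply: filterS x1 => w /=; rewrite vec_triple.
have := same_law_ae _ _ mtriples mtriple (law_samples t tT) _ mA x1'.
by apply: filterS => w /=; rewrite vec_triple.
Qed.

Lemma sample_eps : {ae P, forall w, `|epss t w| <= sigma}.
Proof.
have mA : measurable [set p : d.-tuple R * R * R | `|p.1.2| <= sigma].
  rewrite -[X in measurable X]setTI.
  apply: measurable_fun_le => //; apply: measurableT_comp => //.
  exact: (measurableT_comp measurable_snd measurable_fst).
exact: (same_law_ae _ _ mtriples mtriple (law_samples t tT) _ mA).
Qed.

Lemma measurable_sample : measurable_coords (xs t).
Proof. by apply: measurable_coords_rv2tuple; case: (msamples t tT). Qed.

Lemma ae_bounded_sample i : ae_bounded P (fun w => xs t w ord0 i).
Proof.
split; first exact: measurable_sample.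
exists 1; apply: filterS sample_norm2 => w; apply: le_trans.
exact: ler_coord_norm2.
Qed.

Let Rintegral_sample (f : 'rV[R]_d -> R) : measurable_fun setT (f \o vec) ->
  ae_bounded P (f \o x) -> \int[P]_w f (xs t w) = \int[P]_w f (x w).
Proof.
move=> mf bf.
have fE (Y : O -> 'rV[R]_d) (e c : O -> R) :
    (fun w => f (Y w)) = (f \o vec) \o triple Y e c.
  by apply/funext => w /=; rewrite vec_triple.
rewrite (fE _ (epss t) (bs t)) (fE x eps b).
apply: (same_law_Rintegral _ _ mtriples mtriple (law_samples t tT)) => //.
by rewrite -fE.
Qed.

Lemma sample_mean i : \int[P]_w (xs t w ord0 i - m ord0 i) = 0.
Proof.
rewrite ae_RintegralB ?Rintegral_probability_cst; last 2 first.
- exact: ae_bounded_sample.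
- exact: ae_bounded_cst.
rewrite (Rintegral_sample (fun v => v ord0 i)) -?meanvE ?subrr//.
  exact: measurable_vec.
exact: ae_bounded_generic.
Qed.

Lemma sample_cov i j :
  \int[P]_w ((xs t w ord0 i - m ord0 i) * (xs t w ord0 j - m ord0 j)) =
  covmx P x i j.
Proof.
have mf k : measurable_fun setT (fun p => vec p ord0 k - m ord0 k).
  by apply: measurable_funB => //; exact: measurable_cst.
rewrite (Rintegral_sample
    (fun v => (v ord0 i - m ord0 i) * (v ord0 j - m ord0 j))).
- by rewrite [RHS]mxE unlock.
- exact: measurable_funM.
- by apply: ae_boundedM; apply: ae_boundedB;
    [exact: ae_bounded_generic|exact: ae_bounded_cst
    |exact: ae_bounded_generic|exact: ae_bounded_cst].
Qed.

Lemma measurable_indic_eq0 : measurable_fun setT (\1_[set (0 : R)] : R -> R).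
Proof. exact: measurable_indic. Qed.

Lemma sample_clean : \int[P]_w \1_[set (0 : R)] (bs t w) = 1 - alpha.
Proof.
have bI (c : O -> R) : measurable_fun setT c ->
    ae_bounded P (fun w => \1_[set (0 : R)] (c w) : R).
  move=> mc; split; first exact: measurableT_comp.
  exists 1; apply: aeW => w.
  by rewrite indic_eq0E; case: eqP; rewrite ?normr1 ?normr0.
have -> : \int[P]_w \1_[set (0 : R)] (bs t w) = \int[P]_w \1_[set (0 : R)] (b w).
  apply: (same_law_Rintegral _ _ mtriples mtriple (law_samples t tT)
    (fun p => \1_[set (0 : R)] p.2)); last exact: bI.
  exact: (measurableT_comp measurable_indic_eq0 measurable_snd).
have mN : measurable [set w | b w != 0].
  rewrite (_ : [set w | _] = b @^-1` ~` [set 0]).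
    by rewrite -[X in measurable X]setTI; apply: mb => //; exact: measurableC.
  by apply/seteqP; split => w /= /eqP.
(* The hypothesis gives the probability of [b != 0], hence the passage to the complement. *)
have -> : (fun w => \1_[set (0 : R)] (b w) : R) =
    fun w => 1 - \1_[set w | b w != 0] w.
  apply/funext => w; rewrite indic_eq0E indicE.
  rewrite (_ : (w \in _) = (b w != 0)); last by apply/idP/idP; rewrite inE.
  by case: eqP => _; rewrite ?subr0 ?subrr.
rewrite ae_RintegralB; first last.
- split; first exact: measurable_indic.
  by exists 1; apply: aeW => w; rewrite indicE; case: (_ \in _); rewrite ?normr1 ?normr0.
- exact: ae_bounded_cst.
rewrite Rintegral_probability_cst; congr (_ - _).
by rewrite /Rintegral integral_indic// setIT; exact: (congr1 fine bP).
Qed.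

End sample.

(** * Sigma-algebras generated by blocks of samples *)

Let F_measurable tk : F tk `<=` measurable.
Proof.
have [? [? ?]] := msamples _ (ltn_ord tk.1).
by rewrite /F; case: ifP => _; [|case: ifP => _]; exact: sigmaRV_measurable.
Qed.

Let F_setT tk : F tk setT.
Proof.
by rewrite /F; case: ifP => _; [|case: ifP => _]; exact: sigmaRV_setT.
Qed.

Let F_setI tk : setI_closed (F tk).
Proof.
by rewrite /F; case: ifP => _; [|case: ifP => _]; exact: sigmaRV_setI.
Qed.

(** The points are those of [O], so a random variable can be retyped as a function on [gen K]; its
    measurability there says that it depends only on the sources in [K]. *)
Let gen (K : {set 'I_T * 'I_3}) := g_sigma_algebraType (\bigcup_(tk in [set` K]) F tk).

Let F_gen (K : {set 'I_T * 'I_3}) tk : tk \in K ->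
  F tk `<=` \bigcup_(tk in [set` K]) F tk.
Proof. by move=> tkK A FA; exists tk. Qed.

(** The form in which independence is used below: [X] depends on the single source [tk], and [Y] on
    a block of sources avoiding it. *)
Lemma Rintegral_indep_samples tk (K : {set 'I_T * 'I_3}) (X Y : O -> R) :
  tk \notin K -> (forall B, measurable B -> F tk (X @^-1` B)) ->
  measurable_fun [set: gen K] Y -> ae_bounded P X -> ae_bounded P Y ->
  \int[P]_w (X w * Y w) = \int[P]_w X w * \int[P]_w Y w.
Proof.
move=> tkK FX mY bX bY; apply: Rintegral_indepM => // A B mA mB.
apply: (indep_generated P F tk K) => //; first exact: FX.
by rewrite -[X in (<<s _ >>) X]setTI; exact: mY.
Qed.

Let ys t w := dotv wstar (xs t w) + epss t w + bs t w.
Let v t w := sgd_iter D Rc lam m (fun s => xs s w) (fun s => ys s w) t - wstar.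
(** The clipped residual at u = 0, that is phi_R(- z). It does not involve [xs t], which is what
    makes the noise term centred. *)
Let psi t w := phiR Rc (- (dotv wstar m + epss t w + bs t w)).

Section gen_measurable.
Variable K : {set 'I_T * 'I_3}.

Lemma gen_measurable_xs (s : 'I_T) : (s, inord 0) \in K ->
  measurable_coords (xs s : gen K -> 'rV[R]_d).
Proof.
move=> sK; apply: measurable_coords_rv2tuple; apply: measurable_gsigmaRV.
by apply: subset_trans (F_gen _ _ sK); rewrite /F /= inordK.
Qed.

Lemma gen_measurable_epss (s : 'I_T) : (s, inord 1) \in K ->
  measurable_fun [set: gen K] (epss s).
Proof.
move=> sK; apply: measurable_gsigmaRV.
by apply: subset_trans (F_gen _ _ sK); rewrite /F /= inordK.
Qed.

Lemma gen_measurable_bs (s : 'I_T) : (s, inord 2) \in K ->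
  measurable_fun [set: gen K] (bs s).
Proof.
move=> sK; apply: measurable_gsigmaRV.
by apply: subset_trans (F_gen _ _ sK); rewrite /F /= inordK.
Qed.

Lemma gen_measurable_v t : (t <= T)%N ->
  (forall (s : 'I_T) j, (s < t)%N -> (s, j) \in K) ->
  measurable_coords (v t : gen K -> 'rV[R]_d).
Proof.
move=> tT sK; apply: measurable_coordsB; last exact: measurable_coords_cst.
have mxs s : (s < t)%N -> measurable_coords (xs s : gen K -> 'rV[R]_d).
  move=> st; apply: (gen_measurable_xs (Ordinal (leq_trans st tT))).
  exact: sK.
apply: measurable_sgd_iter => // s st.
pose s' := Ordinal (leq_trans st tT).
apply: measurable_funD; last by apply: (gen_measurable_bs s'); exact: sK.
apply: measurable_funD; last by apply: (gen_measurable_epss s'); exact: sK.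
by apply: measurable_dotv; [exact: measurable_coords_cst|exact: mxs].
Qed.

End gen_measurable.

Lemma norm2_v t w : norm2 (v t w) <= 2 * D.
Proof.
rewrite (le_trans (ler_norm2B _ _))//.
have : norm2 (sgd_iter D Rc lam m (xs^~ w) (ys^~ w) t) <= D.
  case: t => [|t]; last exact: norm2_projW.
  by rewrite /= (eqP (_ : norm2 0 == 0)) ?norm2_eq0// ltW.
by have := wstarD; lra.
Qed.

Lemma measurable_v t : (t <= T)%N -> measurable_coords (v t).
Proof.
move=> tT; apply: measurable_coordsB; last exact: measurable_coords_cst.
have mxs s : (s < t)%N -> measurable_coords (xs s).
  by move=> st; apply: measurable_sample; exact: leq_trans tT.
apply: measurable_sgd_iter => // s st.
have [_ [me mbs]] := msamples s (leq_trans st tT).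
do 2 apply: measurable_funD => //.
by apply: measurable_dotv; [exact: measurable_coords_cst|exact: mxs].
Qed.

Lemma ae_bounded_v t i : (t <= T)%N -> ae_bounded P (fun w => v t w ord0 i).
Proof.
move=> tT; split; first exact: measurable_v.
exists (2 * D); apply: aeW => w.
exact: le_trans (ler_coord_norm2 _ _) (norm2_v _ _).
Qed.

Lemma ae_bounded_vv t : (t <= T)%N -> ae_bounded P (fun w => dotv (v t w) (v t w)).
Proof.
by move=> tT; apply: ae_bounded_sum => i; apply: ae_boundedM; exact: ae_bounded_v.
Qed.

(** * One step of the iteration *)

Section step.
Variables (t : nat) (tT : (t < T)%N).

Let t' := Ordinal tT.
(** [K0] holds the past together with the current [epss t] and [bs t], everything that [xs t] is
    separated from; [K1] is the past alone, from which [bs t] is separated next. *)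
Let K0 : {set 'I_T * 'I_3} :=
  [set tk | (val tk.1 < t)%N || ((tk.1 == t') && (val tk.2 != 0%N))]%SET.
Let K1 : {set 'I_T * 'I_3} := [set tk | (val tk.1 < t)%N]%SET.
Let xc w := xs t w - m.
Let good w : R := \1_[set (0 : R)] (bs t w).

Let xcE w i : xc w ord0 i = xs t w ord0 i - m ord0 i.
Proof. by rewrite /xc [LHS]mxE [X in _ + X]mxE. Qed.

Let bxc i : ae_bounded P (fun w => xc w ord0 i).
Proof.
under eq_fun do rewrite xcE.
by apply: ae_boundedB; [exact: ae_bounded_sample|exact: ae_bounded_cst].
Qed.

Let bgood : ae_bounded P good.
Proof.
have [_ [_ mbs]] := msamples t tT.
split; first exact: (measurableT_comp measurable_indic_eq0).
exists 1; apply: aeW => w.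
by rewrite /good indic_eq0E; case: eqP; rewrite ?normr1 ?normr0.
Qed.

Let bpsi : ae_bounded P (psi t).
Proof.
have [_ [me mbs]] := msamples t tT; split; last first.
  by exists Rc; apply: aeW => w; exact: normr_phiR.
apply: measurable_phiR; apply: measurable_funN.
by do 2 apply: measurable_funD => //; exact: measurable_cst.
Qed.

Let bv i : ae_bounded P (fun w => v t w ord0 i).
Proof. by apply: ae_bounded_v; exact: ltnW. Qed.

Let bu : ae_bounded P (fun w => dotv (v t w) (xc w)).
Proof. by apply: ae_bounded_sum => i; exact: ae_boundedM. Qed.

Let xc_sigma (h : 'rV[R]_d -> R) :
  measurable_fun setT (fun p : d.-tuple R => h (\row_i (tnth p i - m ord0 i))) ->
  forall B, measurable B -> F (t', inord 0) ((h \o xc) @^-1` B).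
Proof.
move=> mh B mB; rewrite /F /= inordK//=.
have -> : h \o xc =
    fun w => h (\row_i (tnth ((rv2tuple \o xs t) w) i - m ord0 i)).
  apply/funext => w /=; congr h.
  by apply/rowP => i; rewrite xcE mxE tnth_mktuple.
exact: (sigmaRV_comp (rv2tuple \o xs t) _ mh).
Qed.

Let K0_x : (t', inord 0) \notin K0.
Proof. by rewrite inE /= ltnn inordK// andbF. Qed.

Let v_K0 : measurable_coords (v t : gen K0 -> 'rV[R]_d).
Proof.
by apply: gen_measurable_v => [|s j st]; [exact: ltnW|rewrite inE /= st].
Qed.

Let measurable_tnthB i :
  measurable_fun setT (fun p : d.-tuple R => tnth p i - m ord0 i).
Proof. by apply: measurable_funB => //; exact: measurable_tnth. Qed.

(** Coordinate by coordinate, [xc] is centred and independent of [psi t] times [v t], which lives on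
    [K0]. *)
Lemma step_noise : \int[P]_w (psi t w * dotv (v t w) (xc w)) = 0.
Proof.
transitivity (\int[P]_w (\sum_i xc w ord0 i * (psi t w * v t w ord0 i))).
  apply: eq_Rintegral => w _; rewrite mulr_sumr; apply: eq_bigr => i _.
  by ring.
rewrite ae_Rintegral_sum => [|i]; last by do 2 apply: ae_boundedM => //.
apply: big1 => i _.
rewrite (Rintegral_indep_samples (t', inord 0) K0)//.
- rewrite [X in X * _](_ : _ = 0) ?mul0r//.
  by under eq_Rintegral do rewrite xcE; exact: sample_mean.
- apply: (xc_sigma (fun u => u ord0 i)).
  by under eq_fun do rewrite mxE; exact: measurable_tnthB.
- apply: measurable_funM => //.
  apply: measurable_phiR; apply: measurable_funN.
  apply: measurable_funD.
    apply: measurable_funD; first exact: measurable_cst.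
    by apply: (gen_measurable_epss K0 t'); rewrite inE /= eqxx inordK ?orbT.
  by apply: (gen_measurable_bs K0 t'); rewrite inE /= eqxx inordK ?orbT.
- exact: ae_boundedM.
Qed.

(** Expand the square into coordinate products and factor twice: the [xc] products give the entries
    of the covariance matrix, and the indicator of a clean sample gives 1 - alpha. The resulting
    quadratic form in [v t] is bounded below pointwise by [psd_ge_quad]. *)
Lemma step_signal :
  lam * \int[P]_w dotv (v t w) (v t w) <=
  \int[P]_w (good w * dotv (v t w) (xc w) ^+ 2).
Proof.
have bvv i j : ae_bounded P (fun w => v t w ord0 i * v t w ord0 j).
  exact: ae_boundedM.
have -> : \int[P]_w (good w * dotv (v t w) (xc w) ^+ 2) =
    \int[P]_w (\sum_i \sum_j (xc w ord0 i * xc w ord0 j) *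
      (good w * (v t w ord0 i * v t w ord0 j))).
  apply: eq_Rintegral => w _; rewrite expr2 mulr_suml mulr_sumr.
  apply: eq_bigr => i _; rewrite !mulr_sumr; apply: eq_bigr => j _.
  by ring.
rewrite [leRHS]ae_Rintegral_sum => [|i]; last first.
  by apply: ae_bounded_sum => j; do 2 apply: ae_boundedM => //.
have -> : \sum_i \int[P]_w (\sum_j (xc w ord0 i * xc w ord0 j) *
      (good w * (v t w ord0 i * v t w ord0 j))) =
    (1 - alpha) * \int[P]_w (\sum_i \sum_j covmx P x i j *
      (v t w ord0 i * v t w ord0 j)).
  rewrite ae_Rintegral_sum => [|i]; last first.
    apply: ae_bounded_sum => j; apply: ae_boundedM => //.
    exact: ae_bounded_cst.
  rewrite mulr_sumr; apply: eq_bigr => i _.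
  rewrite !ae_Rintegral_sum => [|j|j]; last 2 first.
  - by apply: ae_boundedM => //; exact: ae_bounded_cst.
  - by do 2 apply: ae_boundedM => //.
  rewrite mulr_sumr; apply: eq_bigr => j _.
  (* First [xs t] is separated from the rest. *)
  rewrite (Rintegral_indep_samples (t', inord 0) K0)//; first last.
  - exact: ae_boundedM.
  - exact: ae_boundedM.
  - apply: measurable_funM; last exact: measurable_funM.
    apply: (measurableT_comp measurable_indic_eq0).
    by apply: (gen_measurable_bs K0 t'); rewrite inE /= eqxx inordK ?orbT.
  - apply: (xc_sigma (fun u => u ord0 i * u ord0 j)).
    under eq_fun do rewrite [X in X * _]mxE [X in _ * X]mxE.
    by apply: measurable_funM; exact: measurable_tnthB.
  (* Then [bs t] is separated from the past. *)
  rewrite (Rintegral_indep_samples (t', inord 2) K1 good)//; first last.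
  - apply: measurable_funM.
      by apply: gen_measurable_v => [|s k st]; [exact: ltnW|rewrite inE /= st].
    by apply: gen_measurable_v => [|s k st]; [exact: ltnW|rewrite inE /= st].
  - rewrite /F /= inordK//=; apply: (sigmaRV_comp (bs t)).
    exact: measurable_indic_eq0.
  - by rewrite inE /= ltnn.
  rewrite ae_RintegralZl// -(sample_cov t tT) (sample_clean t tT).
  have -> : \int[P]_w (xc w ord0 i * xc w ord0 j) =
      \int[P]_w ((xs t w ord0 i - m ord0 i) * (xs t w ord0 j - m ord0 j)).
    by under eq_Rintegral do rewrite !xcE.
  by ring.
have [_ a1] := andP alpha01.
rewrite /lam -mulrA ler_pM2l ?subr_gt0//.
rewrite -ae_RintegralZl; last by apply: ae_bounded_vv; exact: ltnW.
apply: ae_le_Rintegral.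
- by apply: ae_boundedM; [exact: ae_bounded_cst|apply: ae_bounded_vv; exact: ltnW].
- do 2 apply: ae_bounded_sum => ?; apply: ae_boundedM => //.
  exact: ae_bounded_cst.
- by apply: aeW => w; exact: psd_ge_quad.
Qed.

(** Contraction of the projection towards [wstar], expansion of the square, then [phiR_coercive] on
    the cross term and |g_t| <= 2 Rc on the last term. Samples are counted from 0, so the step size
    is 1 / (lam (t + 1)). *)
Lemma step_pointwise : {ae P, forall w,
  dotv (v t.+1 w) (v t.+1 w) <= dotv (v t w) (v t w)
    - 2 * (lam * t.+1%:R)^-1 * (good w * dotv (v t w) (xc w) ^+ 2)
    - 2 * (lam * t.+1%:R)^-1 * (psi t w * dotv (v t w) (xc w))
    + 4 * Rc ^+ 2 / (lam * t.+1%:R) ^+ 2}.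
Proof.
apply: filterS2 (sample_norm2 t tT) (sample_eps t tT) => w xw ew.
have xcw : norm2 (xc w) <= 2.
  by rewrite (le_trans (ler_norm2B _ _))//; have := norm2_meanv; move: xw; lra.
rewrite [v t.+1 w]/v /=; set W := sgd_iter _ _ _ _ _ _ t.
rewrite -/(xc w).
set eta := (lam * t.+1%:R)^-1.
have eta0 : 0 <= eta by rewrite invr_ge0 mulr_ge0// ltW.
set u := dotv (v t w) (xc w).
set z := dotv wstar m + epss t w + bs t w.
have -> : dotv W (xc w) - ys t w = u - z.
  by rewrite /u /z /ys /v -/W /xc dotvBl !dotvBr; ring.
rewrite (le_trans (projW_contract _ _ _ D0 wstarD))//.
have -> : W - eta *: (phiR Rc (u - z) *: xc w) - wstar =
    v t w - (eta * phiR Rc (u - z)) *: xc w.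
  by rewrite /v -/W scalerA addrAC.
rewrite dotv_sqB dotvZr dotvZl dotvZr -/u -(norm2_sq (xc w)).
(* On a clean sample |z| <= D + sigma, and |u| <= 2 D * 2, so |u - z| <= 5 D + sigma, within the
   clipping level 6 D + sigma. *)
have good_range : bs t w == 0 -> `|u - z| <= Rc /\ `|z| <= Rc.
  move=> /eqP b0.
  have zD : `|z| <= D + sigma.
    rewrite /z b0 addr0 (le_trans (ler_normD _ _))// lerD//.
    rewrite (le_trans (normr_dotv _ _))//.
    by rewrite -[leRHS]mulr1 ler_pM ?norm2_ge0 ?norm2_meanv.
  have uD : `|u| <= 4 * D.
    rewrite (le_trans (normr_dotv _ _))//.
    have -> : 4 * D = (2 * D) * 2 by ring.
    by rewrite ler_pM ?norm2_ge0 ?norm2_v.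
  have D0' := D0; split; last by rewrite /Rc; lra.
  by rewrite (le_trans (ler_normB _ _))// /Rc; lra.
have := phiR_coercive Rc u z _ good_range.
rewrite -indic_eq0E -/(good w) -/(psi t w) => coer.
have phi2 : phiR Rc (u - z) ^+ 2 <= Rc ^+ 2.
  by rewrite -ler_sqrt ?sqr_ge0// !sqrtr_sqr (ger0_norm Rc0) normr_phiR.
have xc2 : norm2 (xc w) ^+ 2 <= 4.
  have -> : 4 = 2 ^+ 2 :> R by ring.
  by rewrite ler_sqr ?nnegrE ?norm2_ge0.
have sq : phiR Rc (u - z) ^+ 2 * norm2 (xc w) ^+ 2 <= Rc ^+ 2 * 4.
  by rewrite ler_pM ?sqr_ge0.
have := ler_wpM2l eta0 coer.
have := ler_wpM2l (sqr_ge0 eta) sq.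
rewrite -exprVn -/eta.
set p := phiR Rc (u - z); set q := norm2 (xc w) ^+ 2; lra.
Qed.

Lemma step_recurrence :
  \int[P]_w dotv (v t.+1 w) (v t.+1 w) <=
  (1 - 2 / t.+1%:R) * \int[P]_w dotv (v t w) (v t w)
  + 4 * Rc ^+ 2 / (lam * t.+1%:R) ^+ 2.
Proof.
set eta := (lam * t.+1%:R)^-1; set C := 4 * _ / _.
have eta0 : 0 <= eta by rewrite invr_ge0 mulr_ge0// ltW.
have bt : ae_bounded P (fun w => dotv (v t w) (v t w)).
  by apply: ae_bounded_vv; exact: ltnW.
have b1 : ae_bounded P (fun w => good w * dotv (v t w) (xc w) ^+ 2).
  by under eq_fun do rewrite expr2; do 2 apply: ae_boundedM => //.
have b2 : ae_bounded P (fun w => psi t w * dotv (v t w) (xc w)).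
  exact: ae_boundedM.
have bc (f : O -> R) c : ae_bounded P f -> ae_bounded P (fun w => c * f w).
  by move=> bf; apply: ae_boundedM => //; exact: ae_bounded_cst.
have bC := @ae_bounded_cst _ _ _ P C.
have b3 := ae_boundedB _ _ bt (bc _ (2 * eta) b1).
have b4 := ae_boundedB _ _ b3 (bc _ (2 * eta) b2).
have := ae_le_Rintegral _ _ (ae_bounded_vv t.+1 tT) (ae_boundedD _ _ b4 bC)
  step_pointwise.
rewrite (ae_RintegralD _ _ b4 bC) (ae_RintegralB _ _ b3 (bc _ _ b2)).
rewrite (ae_RintegralB _ _ bt (bc _ _ b1)) Rintegral_probability_cst.
rewrite !ae_RintegralZl// step_noise mulr0 subr0 => /le_trans; apply.
rewrite lerD2r mulrBl mul1r lerD2l lerN2.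
(* The factor [lam] of the strong convexity bound cancels the one in the step size, leaving the
   contraction 2 / (t + 1). *)
have -> : 2 / t.+1%:R * \int[P]_w dotv (v t w) (v t w) =
    2 * eta * (lam * \int[P]_w dotv (v t w) (v t w)).
  have cancel_lam (n l I : R) : n != 0 -> l != 0 ->
      2 / n * I = 2 * (l * n)^-1 * (l * I).
    by move=> n0 l0; field; rewrite n0 l0.
  by rewrite -cancel_lam// ?pnatr_eq0// gt_eqF.
by rewrite ler_wpM2l ?mulr_ge0//; exact: step_signal.
Qed.

End step.

(** * Rate for the iterates and for their tail average *)

Lemma iterate_rate k : (0 < k <= T)%N ->
  \int[P]_w dotv (v k w) (v k w) <= 2 * (4 * Rc ^+ 2 / lam ^+ 2) / k.+1%:R.
Proof.
apply: (recurrence_rate (fun k => \int[P]_w dotv (v k w) (v k w)) _ T).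
- by apply: divr_ge0; [apply: mulr_ge0 => //; exact: sqr_ge0|exact: sqr_ge0].
- by apply: Rintegral_ge0 => w _; exact: dotv_ge0.
- move=> j jT; have := step_recurrence j jT.
  by rewrite exprMn invfM mulrA.
Qed.

Lemma sgd_output_rate : (0 < T)%N -> ~~ odd T ->
  ('E_P[(fun w => norm2 (sgd_output D Rc lam m (fun t => xs t w)
      (fun t => ys t w) T - wstar) ^+ 2)%R]
   <= (72 * Rc ^+ 2 / (lam ^+ 2 * T%:R))%:E)%E.
Proof.
move=> T0 evenT; pose h := T./2.
have TE : T = (h + h)%N by rewrite addnn /h even_halfK.
have h0 : (0 < h)%N by move: T0; rewrite TE; case: (h).
have hR : 0 < h%:R :> R by rewrite ltr0n.
have cE : 2 / T%:R = h%:R^-1 :> R.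
  by rewrite TE natrD; field; rewrite !gt_eqF// addr_gt0.
have TsubE : (T - h)%N = h by rewrite TE addnK.
pose Q w := \sum_(h <= k < T) dotv (v k w) (v k w).
(* Summing over ordinals keeps k < T in the type of the index, since the lemmas on sums ask for
   boundedness and measurability at every index. *)
pose s := [seq k : 'I_T <- index_enum 'I_T | (h <= k)%N].
have sE (M : nmodType) (f : nat -> M) :
    \sum_(h <= k < T) f k = \sum_(k <- s) f (val k).
  by rewrite big_geq_mkord -big_filter.
have bQ : ae_bounded P Q.
  rewrite /Q; under eq_fun do rewrite sE.
  by apply: ae_bounded_sum => k; exact: ae_bounded_vv (ltnW (ltn_ord k)).
have outE w : sgd_output D Rc lam m (fun t => xs t w) (fun t => ys t w) T
    - wstar = h%:R^-1 *: \sum_(h <= k < T) v k w.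
  rewrite /sgd_output cE -/h sumrB scalerBr; congr (_ - _).
  rewrite sumr_const_nat TsubE -[X in _ *: X](scaler_nat h wstar) scalerA.
  by rewrite mulVf ?scale1r ?gt_eqF.
have pointwise w : norm2 (sgd_output D Rc lam m (fun t => xs t w)
    (fun t => ys t w) T - wstar) ^+ 2 <= h%:R^-1 * Q w.
  rewrite outE norm2_sq dotvZl dotvZr ler_pM2l ?invr_gt0// ler_pdivrMl//.
  have := dotv_sum_sq_le _ (index_iota h T) (v^~ w).
  by rewrite size_iota TsubE.
have mout : measurable_fun setT (fun w => norm2 (sgd_output D Rc lam m
    (fun t => xs t w) (fun t => ys t w) T - wstar) ^+ 2).
  apply: measurable_funX; apply: measurable_norm2.
  under eq_fun do rewrite outE sE.
  apply: measurable_coordsZ; first exact: measurable_cst.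
  by apply: measurable_coords_sum => k; apply: measurable_v; exact: ltnW (ltn_ord k).
have bhQ : ae_bounded P (fun w => h%:R^-1 * Q w).
  by apply: ae_boundedM => //; exact: ae_bounded_cst.
pose bound w : R := h%:R^-1 * Q w.
apply: (@le_trans _ _ ('E_P[bound])%E).
  apply: expectation_le => //.
  - by case: bhQ.
  - by move=> w; exact: sqr_ge0.
  - by move=> w; exact: le_trans (sqr_ge0 _) (pointwise w).
  - exact: aeW.
rewrite expectation_Rintegral// lee_fin /bound ae_RintegralZl//.
set G := 4 * Rc ^+ 2 / lam ^+ 2.
have G0 : 0 <= G.
  by apply: divr_ge0; [apply: mulr_ge0 => //; exact: sqr_ge0|exact: sqr_ge0].
have intQ : \int[P]_w Q w <= h%:R * (2 * G / h%:R).
  rewrite /Q; under eq_Rintegral do rewrite sE.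
  rewrite ae_Rintegral_sum => [|k]; last by apply: ae_bounded_vv; exact: ltnW (ltn_ord k).
  rewrite -(sE _ (fun k => \int[P]_w dotv (v k w) (v k w))).
  (* The right-hand side becomes a sum of T - h = h equal terms, and the sums are compared termwise:
     2 G / (k + 1) <= 2 G / h for k >= h. *)
  rewrite mulr_natl -[X in _ *+ X]TsubE -sumr_const_nat !big_nat.
  apply: ler_sum => k /andP[hk kT]; have k0 : (0 < k)%N by exact: leq_trans hk.
  apply: le_trans (iterate_rate k _) _; first by rewrite k0 ltnW.
  apply: ler_wpM2l; first exact: mulr_ge0.
  rewrite lef_pV2 ?posrE ?ltr0n// ler_nat.
  exact: leq_trans (leqnSn k).
apply: (@le_trans _ _ (2 * G / h%:R)).
  by rewrite ler_pdivrMl.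
(* With G = 4 Rc^2 / lam^2 and h = T / 2 the constant is 16, which is below 72. *)
have -> : 2 * G / h%:R = 16 * Rc ^+ 2 / (lam ^+ 2 * T%:R).
  by rewrite TE natrD /G; field; rewrite !gt_eqF// addr_gt0.
apply: ler_wpM2r; first by rewrite invr_ge0 mulr_ge0 ?(sqr_ge0 lam).
by rewrite ler_wpM2r ?sqr_ge0 ?ler_nat.
Qed.

End sgd_analysis.

Theorem theorem2 (R : realType) (d : nat) (D sigma alpha rho : R) (T : nat)
  (wstar : 'rV[R]_d)
  (dO : measure_display) (O : measurableType dO) (P : probability O R)
  (x : O -> 'rV[R]_d) (eps b : O -> R)
  (xs : nat -> O -> 'rV[R]_d) (epss bs : nat -> O -> R) :
  (1 <= d)%N -> 0 < D -> 0 <= sigma -> 0 <= alpha < 1 -> 0 < rho ->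
  (0 < T)%N -> ~~ odd T ->
  norm2 wstar <= D ->
  (* the generic triple (x, eps, b) *)
  measurable_fun setT (rv2tuple \o x) -> measurable_fun setT eps ->
  measurable_fun setT b ->
  mutually_independent P
    (fun k : 'I_3 => if val k == 0%N then sigmaRV (rv2tuple \o x)
                     else if val k == 1%N then sigmaRV eps else sigmaRV b) ->
  {ae P, forall w, norm2 (x w) <= 1} ->
  psd_ge (covmx P x) rho ->
  {ae P, forall w, `|eps w| <= sigma} ->
  ('E_P[eps] = 0)%E ->
  P [set w | b w != 0] = alpha%:E ->
  (* T fresh independent samples (x_t, eps_t, b_t), t = 1..T, stored at
     indices 0..T-1, each distributed as (x, eps, b) *)
  (forall t, (t < T)%N -> measurable_fun setT (rv2tuple \o xs t) /\
     measurable_fun setT (epss t) /\ measurable_fun setT (bs t)) ->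
  (forall t, (t < T)%N -> same_law P (triple (xs t) (epss t) (bs t)) (triple x eps b)) ->
  mutually_independent P
    (fun tk : 'I_T * 'I_3 =>
       if val tk.2 == 0%N then sigmaRV (rv2tuple \o xs (val tk.1))
       else if val tk.2 == 1%N then sigmaRV (epss (val tk.1))
       else sigmaRV (bs (val tk.1))) ->
  let Rc := 6 * D + sigma in
  let lam := (1 - alpha) * rho in
  let m := meanv P x in
  let wbar := fun w => sgd_output D Rc lam m (fun t => xs t w)
                 (fun t => dotv wstar (xs t w) + epss t w + bs t w) T in
  ('E_P[(fun w => norm2 (wbar w - wstar) ^+ 2)%R]
     <= (72 * Rc ^+ 2 / (((1 - alpha) * rho) ^+ 2 * T%:R))%:E)%E.
Proof.
move=> _ D0 sigma0 alpha01 rho0 T0 evenT wstarD mx meps mb _ x1 covx epsS _ bP.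
move=> msamples law_samples indF.
exact: (sgd_output_rate D0 sigma0 alpha01 rho0 wstarD mx meps mb x1 covx epsS
  bP msamples law_samples indF T0 evenT).
Qed.
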